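(* Let $G$ be a (theta, prism)-free graph, let $H$ be an induced subgraph of $G$, and let $a\in V(H)$ be trapped in $H$. Let $\Sigma$ be a pyramid in $H$ with apex $a$, base $b_1b_2b_3$ and paths $P_1,P_2,P_3$. Let $P$ be a path in $G\setminus H$. Then one of the following holds: (1) $N_\Sigma(P)$ is local in $\Sigma$; (2) $P$ contains (as a subpath, possibly a single vertex) a corner path for $\Sigma$; (3) some vertex of $P$ is a jewel for $\Sigma$.
   Context: All graphs are finite and simple; induced subgraphs are identified with their vertex sets; a ''path in $G$'' is an induced subgraph of $G$ that is a path; length = number of edges. For $X\subseteq V(G)$ and a set $Y$, $N_X(Y)$ is the set of vertices of $X\setminus Y$ with a neighbor in $Y$. Complete/anticomplete: all/no edges between two sets. Theta: two non-adjacent vertices with three internally disjoint paths between them of length at least two with pairwise anticomplete interiors. Prism: two disjoint triangles $\{a_1,a_2,a_3\},\{b_1,b_2,b_3\}$ and disjoint paths $P_i$ from $a_i$ to $b_i$ such that for $i\neq j$ the only edges between $P_i$ and $P_j$ are $a_ia_j,b_ib_j$. A pyramid consists of a vertex $a$ (apex), a triangle $\{b_1,b_2,b_3\}$ (base) and three paths $P_1,P_2,P_3$ of length at least one, $P_i$ from $a$ to $b_i$, otherwise pairwise disjoint, such that for distinct $i,j$, $b_ib_j$ is the only edge between $P_i\setminus\{a\}$ and $P_j\setminus\{a\}$, and at most one $P_i$ has length exactly one; a pyramid in $G$ is an induced subgraph that is a pyramid. A vertex $a$ is trapped in $H$ if every vertex at distance at most two from $a$ in $G$ lies in $H$ and every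 neighbor of $a$ has degree two in $H$. A set $X\subseteq\Sigma$ is local in $\Sigma$ if $X\subseteq P_i$ for some $i$ or $X\subseteq\{b_1,b_2,b_3\}$. For a path $Q$ in $G\setminus\Sigma$ with (not necessarily distinct) ends $q_1,q_2$, $Q$ is a corner path for $\Sigma$ at $b_i$ if $q_1$ has a neighbor in $P_i\setminus\{b_i\}$, $q_2$ is complete to $\{b_1,b_2,b_3\}\setminus\{b_i\}$, and apart from these edges there is no edge between $Q$ and $\Sigma\setminus\{b_i\}$; a corner path for $\Sigma$ is one at some $b_i$. A vertex $p\notin\Sigma$ is a jewel for $\Sigma$ at $b_i$ if $p$ is anticomplete to $P_i$ and for each $j\neq i$, $N_{P_j}(p)=N_{P_j}[b_j]$; a jewel for $\Sigma$ is one at some $b_i$. *)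

(* Defs.v *)
From mathcomp Require Import all_boot.

Set Implicit Arguments.
Unset Strict Implicit.
Unset Printing Implicit Defensive.

(* A finite simple graph is a symmetric irreflexive relation e on a finite
   type T; an induced subgraph is its vertex set. *)
Section Graph.

Variables (T : finType) (e : rel T).
Implicit Types (a x y z : T) (b : 'I_3 -> T) (s Q : seq T).
Implicit Types (H S X Y : {set T}) (P : 'I_3 -> seq T).

Definition nbrs X Y : {set T} := [set x in X :\: Y | [exists y in Y, e x y]].

Definition degree_in H x : nat := #|nbrs H [set x]|.

Definition dist_le k x y : Prop :=
  exists p : seq T, [/\ path e x p, last x p = y & size p <= k].

(* A path in G is listed from one end to the other; since it is an induced
   subgraph, two of its vertices are adjacent exactly when they are
   consecutive in the list. *)
Definition is_path s : Prop :=
  [/\ 0 < size s, uniq s &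
      forall x y, x \in s -> y \in s ->
        e x y = (index y s == (index x s).+1) || (index x s == (index y s).+1)].

Definition path_between x y s : Prop :=
  [/\ is_path s, head x s = x & last y s = y].

Definition path_length s : nat := (size s).-1.

Definition triangle b : Prop := forall i j, i != j -> e (b i) (b j).

Definition is_theta x y P : Prop :=
  [/\ x != y, ~~ e x y,
      forall i, path_between x y (P i) /\ 2 <= path_length (P i),
      forall i j z, i != j -> z \in P i -> z \in P j -> z \in [:: x; y] &
      forall i j u v, i != j -> u \in P i -> v \in P j ->
        u \notin [:: x; y] -> v \notin [:: x; y] -> ~~ e u v].

Definition theta_free : Prop := forall x y P, ~ is_theta x y P.

Definition is_prism (b b' : 'I_3 -> T) P : Prop :=
  [/\ triangle b /\ triangle b',
      forall i j, b i != b' j,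
      forall i, path_between (b i) (b' i) (P i),
      forall i j z, i != j -> z \in P i -> z \notin P j &
      forall i j u v, i != j -> u \in P i -> v \in P j -> e u v ->
        (u = b i /\ v = b j) \/ (u = b' i /\ v = b' j)].

Definition prism_free : Prop := forall b b' P, ~ is_prism b b' P.

Definition is_pyramid a b P : Prop :=
  [/\ triangle b,
      forall i, path_between a (b i) (P i) /\ 1 <= path_length (P i),
      forall i j z, i != j -> z \in P i -> z \in P j -> z = a,
      forall i j u v, i != j -> u \in P i -> v \in P j -> u != a -> v != a ->
        e u v -> u = b i /\ v = b j &
      forall i j, path_length (P i) = 1 -> path_length (P j) = 1 -> i = j].

Definition pyr_set P : {set T} := [set x | [exists i, x \in P i]].

Definition trapped H a : Prop :=
  (forall x, dist_le 2 a x -> x \in H) /\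
  (forall y, e a y -> degree_in H y = 2).

Definition local_in b P X : Prop :=
  (exists i, {subset X <= P i}) \/ (forall x, x \in X -> exists i, x = b i).

(* The ends q1 and q2 of Q play different roles, and Q is listed from q1
   to q2. *)
Definition corner_path_at b P i Q : Prop :=
  exists q1 q2,
    [/\ path_between q1 q2 Q,
        forall x, x \in Q -> x \notin pyr_set P,
        exists y, [/\ y \in P i, y != b i & e q1 y],
        forall j, j != i -> e q2 (b j) &
        forall x y, x \in Q -> y \in pyr_set P :\ b i -> e x y ->
          (x = q1 /\ y \in P i) \/ (x = q2 /\ exists2 j, j != i & y = b j)].

Definition corner_path b P Q : Prop := exists i, corner_path_at b P i Q.

Definition jewel_at b P i x : Prop :=
  [/\ x \notin pyr_set P,
      forall y, y \in P i -> ~~ e x y &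
      forall j, j != i ->
        nbrs [set z in P j] [set x] = b j |: nbrs [set z in P j] [set b j]].

Definition jewel b P x : Prop := exists i, jewel_at b P i x.

End Graph.

(* Q is a subpath of R; either may be listed from either end. *)
Definition subpath (T : eqType) (Q R : seq T) : bool :=
  infix Q R || infix (rev Q) R.

(* Main.v *)
(* Trapping forbids a vertex off [H] to see the apex [a] or a neighbor of [a].
   Pass to a shortest subpath of [P] with nonlocal attachments, with ends q1 and
   q2. A single vertex with a neighbor on all three legs, at least two of them
   away from the base, makes a theta with [a]. A subpath joining leg i away from
   its foot to exactly one other foot b_j makes a theta with ends [a] and b_j, so
   if it meets the other legs only in feet it meets both of them and is a corner
   path. The remaining case joins leg i to leg j away from both feet and misses
   the third leg: thetas force q1 to have exactly two, consecutive, neighbors on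
   leg i, a prism forces one of them to be the foot, and the same holds for q2 on
   leg j; then q1 = q2 is a jewel, as q1 <> q2 gives a prism. Thetas and prisms
   are obtained by taking induced paths inside pairwise separated connected
   sets. *)
Require Import Defs.
From mathcomp Require Import all_boot.
From mathcomp Require Import zify.

Set Implicit Arguments.
Unset Strict Implicit.
Unset Printing Implicit Defensive.

(** * Induced paths and connectivity inside a vertex set *)

Section InducedPaths.

Variables (T : finType) (e : rel T).
Hypotheses (e_sym : symmetric e) (e_irr : irreflexive e).
Implicit Types (x y z u v : T) (s t : seq T) (A B S : {set T}).

Lemma is_path1 x : is_path e [:: x].
Proof.
split=> // u v; rewrite !inE => /eqP-> /eqP->.
by rewrite e_irr /= eqxx.
Qed.

Lemma is_path_cons x y s :
  is_path e (y :: s) -> e x y -> x \notin y :: s ->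
  (forall z, z \in s -> ~~ e x z) -> is_path e (x :: y :: s).
Proof.
move=> [_ us es] exy xNs xs; split=> //; first by rewrite cons_uniq xNs.
have xP v : v \in y :: s -> e x v = (index v (y :: s) == 0).
  rewrite inE => /predU1P[->|vs]; first by rewrite exy /= eqxx.
  have yNv : (y == v) = false.
    by apply/negbTE/eqP=> yv; move: us; rewrite cons_uniq yv vs.
  by rewrite (negbTE (xs _ vs)) /= yNv.
have idx v : v \in y :: s ->
    index v (x :: y :: s) = (index v (y :: s)).+1.
  by move=> vs; rewrite [LHS]/=; case: eqP => // xv; rewrite xv vs in xNs.
have idx0 : index x (x :: y :: s) = 0 by rewrite /= eqxx.
move=> u v; rewrite !(in_cons x).
move=> /predU1P[->|us'] /predU1P[->|vs'].
- by rewrite e_irr idx0.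
- by rewrite xP // idx0 idx // orbF.
- by rewrite e_sym xP // idx0 idx.
- by rewrite !idx // es.
Qed.

Lemma is_path_infix t s :
  infix t s -> 0 < size t -> is_path e s -> is_path e t.
Proof.
move=> /infixP[t1 [t2 ->]] t_gt0 [_ us es]; split=> //.
  by move: us; rewrite !cat_uniq => /and3P[_ _ /and3P[]].
have idx u : u \in t -> index u (t1 ++ t ++ t2) = size t1 + index u t.
  move=> ut; rewrite !index_cat ut; case: ifP => // ut1.
  move: us; rewrite cat_uniq => /and3P[_ /hasP[]]; exists u => //.
  by rewrite mem_cat ut.
move=> u v ut vt; rewrite es ?mem_cat ?ut ?vt ?orbT //.
by rewrite !idx // -addnS -addnS !eqn_add2l.
Qed.

Lemma is_path_rev s : is_path e s -> is_path e (rev s).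
Proof.
move=> [s_gt0 us es]; split; rewrite ?size_rev ?rev_uniq //.
have idx u : u \in s -> index u (rev s) + (index u s).+1 = size s.
  move=> us'; have lt_u := us'; rewrite -index_mem in lt_u.
  have {1}-> : u = nth u (rev s) (size s - (index u s).+1).
    rewrite nth_rev; last by lia.
    by rewrite subnSK // subKn ?nth_index // ltnW.
  have lt_r : size s - (index u s).+1 < size (rev s) by rewrite size_rev; lia.
  rewrite index_uniq ?rev_uniq //. exact: subnK.
move=> u v; rewrite !mem_rev => us' vs'; rewrite es //.
by have := idx u us'; have := idx v vs'; lia.
Qed.

Lemma path_between_rev x y s :
  path_between e x y s -> path_between e y x (rev s).
Proof.
move=> [p hx ly]; split; first exact: is_path_rev.
- by case: p; case/lastP: s hx ly => // s z; rewrite last_rcons rev_rcons.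
- by case: p; case: s hx ly => // z s /= -> _; rewrite rev_cons last_rcons.
Qed.

(** Reflexivity makes [conn S x x] hold even for [x] outside [S], so extracting a path asks for
    [x \in S] separately. *)
Definition conn S x y :=
  connect [rel u v | [&& u \in S, v \in S & e u v]] x y.

Lemma conn_edge S x y : x \in S -> y \in S -> e x y -> conn S x y.
Proof. by move=> xS yS exy; apply: connect1; rewrite /= xS yS. Qed.

Lemma conn_trans S x y z : conn S x y -> conn S y z -> conn S x z.
Proof. exact: connect_trans. Qed.

Lemma conn_sym S x y : conn S x y = conn S y x.
Proof.
apply: sym_connect_sym => u v /=.
by rewrite e_sym andbCA.
Qed.

Lemma conn_sub A S x y : A \subset S -> conn A x y -> conn S x y.
Proof.
move=> /subsetP AS; apply: connect_sub => u v /and3P[uA vA euv].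
by apply: conn_edge; rewrite ?AS.
Qed.

(* Prepending [x] to an induced path: cut the path at the last occurrence or
   neighbor of [x]. *)
Lemma path_prepend x y s :
  is_path e s -> last x s = y -> x \in s \/ (exists2 z, z \in s & e x z) ->
  exists t, path_between e x y t /\ {subset t <= x :: s}.
Proof.
elim: s => [[]//|z s IHs] zs_path zs_last nbr_x.
case: (boolP [exists w in s, (w == x) || e x w]) => [/exists_inP[w ws xw]|].
  have s_path : is_path e s.
    apply: (is_path_infix _ _ zs_path); last by case: (s) ws.
    by apply/infixP; exists [:: z], [::]; rewrite cats0.
  have [|| t [tP ts]] := IHs s_path.
  - by move: zs_last => /=; case: (s) ws.
  - by case/orP: xw => [/eqP <-|]; [left|right; exists w].
  exists t; split=> // u /ts; rewrite !inE => /orP[->//|->].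
  by rewrite !orbT.
move=> /exists_inPn noS.
have xNs : x \notin s by apply/negP=> /noS; rewrite eqxx.
have exs u : u \in s -> ~~ e x u by move=> /noS; rewrite negb_or => /andP[].
have [zx|zNx] := eqVneq z x.
  by exists (z :: s); split; [split | move=> u us; rewrite inE us orbT].
have exz : e x z.
  case: nbr_x => [|[w]].
    by rewrite inE eq_sym (negbTE zNx) (negbTE xNs).
  by rewrite inE => /predU1P[->//|/exs/negP].
exists (x :: z :: s); split=> //; split=> //.
by apply: is_path_cons => //; rewrite inE eq_sym negb_or zNx.
Qed.

(** A connecting walk is rebuilt from its far end; each earlier vertex is prepended with shortcuts,
    which keeps the path induced and inside [S]. *)
Lemma conn_path S x y : x \in S -> conn S x y ->
  exists s, path_between e x y s /\ {subset s <= S}.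
Proof.
move=> xS /connectP[p]; elim: p x xS => [|z p IHp] x xS /=.
  move=> _ ->; exists [:: x]; split; last by move=> u; rewrite inE => /eqP->.
  by split=> //; apply: is_path1.
move=> /andP[/and3P[_ zS exz] zp] ly.
have [s [[s_path hs ls] sS]] := IHp z zS zp ly.
have s_gt0 : 0 < size s by case: s_path.
have zs : z \in s by case: (s) hs s_gt0 => //= w s' -> _; rewrite inE eqxx.
have [||t [tP ts]] := @path_prepend x y s s_path.
- by rewrite -ls; case: (s) s_gt0.
- by right; exists z.
by exists t; split=> // u /ts; rewrite inE => /predU1P[->|/sS].
Qed.

Lemma path_seg_conn s S x y :
  is_path e s -> x \in s -> y \in s -> index x s <= index y s ->
  (forall z, z \in s -> index x s <= index z s <= index y s -> z \in S) ->
  conn S x y.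
Proof.
move=> [_ us es]; move: {2}(index y s - index x s) (leqnn (index y s - index x s)) => n.
elim: n x => [|n IHn] x le_n xs ys le_xy sS.
  suff -> : x = y by apply: connect0.
  by by apply: (index_inj x xs ys); lia.
have [eq_xy|ne_xy] := eqVneq (index x s) (index y s).
  by rewrite (index_inj x xs ys eq_xy); apply: connect0.
have lt_y : index y s < size s by rewrite index_mem.
have lt_x : (index x s).+1 < size s by lia.
pose z := nth x s (index x s).+1.
have zs : z \in s by exact: mem_nth.
have iz : index z s = (index x s).+1 by exact: index_uniq.
apply: (@conn_trans _ _ z).
  apply: conn_edge; rewrite ?sS //; try lia.
  by rewrite es // iz eqxx.
by apply: IHn => //; try lia; move=> w ws iw; apply: sS => //; lia.
Qed.

(** * Thetas and prisms from separated connected sets *)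

Definition sep A B := forall u v, u \in A -> v \in B -> u != v /\ ~~ e u v.

Lemma sep_sym A B : sep A B -> sep B A.
Proof. by move=> h u v uB vA; have [] := h v u vA uB; rewrite eq_sym e_sym. Qed.

Lemma sepUl A B S : sep A S -> sep B S -> sep (A :|: B) S.
Proof. by move=> hA hB u v; rewrite inE => /orP[]; [apply: hA|apply: hB]. Qed.

Lemma sepUr A B S : sep S A -> sep S B -> sep S (A :|: B).
Proof. by move=> hA hB; apply/sep_sym/sepUl; apply/sep_sym. Qed.

(** Connectivity gives an induced path from [x] to [y] through each set; the interiors stay in [A],
    [B] and [S] and inherit their separation. The sets may hold further vertices, so exact interiors
    never have to be described. *)
Lemma theta_of_sets x y A B S :
  theta_free e -> x != y -> ~~ e x y ->
  conn (x |: (y |: A)) x y -> conn (x |: (y |: B)) x y ->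
  conn (x |: (y |: S)) x y ->
  sep A B -> sep A S -> sep B S -> False.
Proof.
move=> no_theta xNy Nexy cA cB cS sAB sAS sBS.
pose C (i : 'I_3) := nth set0 [:: A; B; S] i.
have /(_ _)/conn_path pC i : conn (x |: (y |: C i)) x y.
  by case: i => -[|[|[]]].
have sC i j : i != j -> sep (C i) (C j).
  case: i j => -[|[|[|//]]] ? [] -[|[|[|//]]] ? //= _;
  by rewrite /C /=; try exact: sep_sym.
have {pC} pC i : exists s, path_between e x y s /\ {subset s <= x |: (y |: C i)}.
  by apply: pC; rewrite !inE eqxx.
have [P PP] := fin_all_exists pC.
have PC i u : u \in P i -> u \notin [:: x; y] -> u \in C i.
  move=> /(proj2 (PP i)); rewrite !inE negb_or.
  by case/or3P=> [->//|->|//]; rewrite andbF.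
apply: (no_theta x y P); split=> // [i|i j z ij zi zj|i j u v ij ui vj ux vx].
- split; first by case: (PP i).
  (* A list of one vertex would give [x = y], and one of two vertices an edge between [x] and
     [y]. *)
  have [[[P0 uP eP] hP lP] _] := PP i; rewrite /path_length.
  case: (P i) P0 uP eP hP lP => [|u [|v [|w s]]] //= _ uP eP hu lv.
    by rewrite -hu -lv eqxx in xNy.
  case/negP: Nexy; rewrite -hu -lv eP ?inE ?eqxx ?orbT //=.
  by move: uP; rewrite inE andbT => /negbTE->; rewrite eqxx.
- apply/negPn/negP => zN; have [] := sC i j ij z z (PC _ _ zi zN) (PC _ _ zj zN).
  by rewrite eqxx.
- by have [] := sC i j ij u v (PC _ _ ui ux) (PC _ _ vj vx).
Qed.

(** The two excepted edges are the triangle edges that a prism allows between two of its paths. *)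
Definition sep_but A B x y x' y' := forall u v, u \in A -> v \in B ->
  u != v /\ (e u v -> u = x /\ v = y \/ u = x' /\ v = y').

Lemma sep_but_sym A B x y x' y' :
  sep_but A B x y x' y' -> sep_but B A y x y' x'.
Proof.
move=> h u v uB vA; have [] := h v u vA uB; rewrite eq_sym e_sym.
by move=> ? h'; split=> // /h'[[-> ->]|[-> ->]]; [left|right].
Qed.

(** Separation up to triangle edges passes from the sets to induced paths inside them. The
    inequalities [x1 != y1] and so on, with disjointness of the sets, keep the two triangles
    disjoint. *)
Lemma prism_of_sets x1 x2 x3 y1 y2 y3 A B S :
  prism_free e ->
  e x1 x2 -> e x1 x3 -> e x2 x3 -> e y1 y2 -> e y1 y3 -> e y2 y3 ->
  x1 != y1 -> x2 != y2 -> x3 != y3 ->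
  x1 \in A -> x2 \in B -> x3 \in S -> y1 \in A -> y2 \in B -> y3 \in S ->
  conn A x1 y1 -> conn B x2 y2 -> conn S x3 y3 ->
  sep_but A B x1 x2 y1 y2 -> sep_but A S x1 x3 y1 y3 ->
  sep_but B S x2 x3 y2 y3 -> False.
Proof.
move=> no_prism ex12 ex13 ex23 ey12 ey13 ey23 n1 n2 n3.
move=> x1A x2B x3S y1A y2B y3S cA cB cS sAB sAS sBS.
pose C (i : 'I_3) := nth set0 [:: A; B; S] i.
pose x (i : 'I_3) := nth x1 [:: x1; x2; x3] i.
pose y (i : 'I_3) := nth y1 [:: y1; y2; y3] i.
have xC i : x i \in C i by case: i => -[|[|[]]].
have yC i : y i \in C i by case: i => -[|[|[]]].
have xNy i : x i != y i by case: i => -[|[|[]]].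
have cC i : conn (C i) (x i) (y i) by case: i => -[|[|[]]].
have sC i j : i != j -> sep_but (C i) (C j) (x i) (x j) (y i) (y j).
  case: i j => -[|[|[|//]]] ? [] -[|[|[|//]]] ? //= _;
  by rewrite /C /x /y /=; try exact: sep_but_sym.
have [P PP] := fin_all_exists (fun i => conn_path (xC i) (cC i)).
have PC i u : u \in P i -> u \in C i by move=> /(proj2 (PP i)).
apply: (no_prism x y P); split=> [|i j|i|i j z ij zi|i j u v ij ui vj].
- split=> -[[|[|[|//]]] ?] [[|[|[|//]]] ?] //= _;
  by rewrite /x /y /= // e_sym.
- by have [<-//|ij] := eqVneq i j; have [] := sC i j ij (x i) (y j) (xC i) (yC j).
- by case: (PP i).
- by apply/negP=> zj; have [] := sC i j ij z z (PC _ _ zi) (PC _ _ zj); rewrite eqxx.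
- by have [] := sC i j ij u v (PC _ _ ui) (PC _ _ vj).
Qed.

End InducedPaths.

(* Plain [lia] also splits on the irrelevant boolean hypotheses. *)
Ltac nat_lia :=
  repeat match goal with h : is_true ?c |- _ =>
    lazymatch c with
    | leq _ _ => fail
    | andb _ _ => fail
    | orb _ _ => fail
    | _ => clear h
    end
  end; lia.

(** * Naming the three legs *)

Lemma ord3_third (i j k m : 'I_3) :
  i != j -> i != k -> j != k -> m != i -> m != k -> m = j.
Proof.
case: i j k m => [i i3] [j j3] [k k3] [m m3]; rewrite -!val_eqE /= => *.
by apply: val_inj => /=; lia.
Qed.

Lemma ord3_other (i j : 'I_3) : i != j -> exists k, i != k /\ j != k.
Proof.
case: i j => [i i3] [j j3]; rewrite -val_eqE /= => ij.
have k3 : 3 - i - j < 3 by lia.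
by exists (Ordinal k3); rewrite -!val_eqE /=; split; lia.
Qed.

(** * Positions and adjacency along the legs of a pyramid *)

Section Pyramid.

Variables (T : finType) (e : rel T).
Hypotheses (e_sym : symmetric e) (e_irr : irreflexive e).
Hypotheses (no_theta : theta_free e) (no_prism : prism_free e).
Variables (H : {set T}) (a : T) (b : 'I_3 -> T) (P : 'I_3 -> seq T).
Hypotheses (pyrP : is_pyramid e a b P) (PH : pyr_set P \subset H).
(* The only use of trapping: position 0 on [P i] is [a], position 1 its
   neighbor, so a vertex off [H] sees neither. *)
Hypothesis far_apex : forall u z i,
  u \notin H -> z \in P i -> e u z -> 1 < index z (P i).
Implicit Types (i j k : 'I_3) (u v x y z q : T) (Q S : {set T}).

(** This is also the length of leg [i], since positions start with 0 at the apex. *)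
Let l i := index (b i) (P i).

Lemma pyr_path i : is_path e (P i).
Proof. by have [_ /(_ i)[[]]] := pyrP. Qed.

Lemma apex_in i : a \in P i.
Proof.
have [_ /(_ i)[[[P0 _ _] ha _] _] _ _ _] := pyrP.
by case: (P i) P0 ha => //= x s _ ->; rewrite inE eqxx.
Qed.

Lemma foot_in i : b i \in P i.
Proof.
have [_ /(_ i)[[[P0 _ _] _ lb] _] _ _ _] := pyrP.
by rewrite -lb; case: (P i) P0 => //= x s _; apply: mem_last.
Qed.

Lemma index_apex i : index a (P i) = 0.
Proof.
have [_ /(_ i)[[[P0 _ _] ha _] _] _ _ _] := pyrP.
by case: (P i) P0 ha => //= x s _ ->; rewrite eqxx.
Qed.

Lemma index_foot i : l i = (size (P i)).-1.
Proof.
have [_ /(_ i)[[[P0 uP _] _ lb] _] _ _ _] := pyrP.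
rewrite /l -lb; case: (P i) P0 uP => //= x s _ uP.
exact: index_last.
Qed.

Lemma index_foot_gt0 i : 0 < l i.
Proof. by rewrite index_foot; have [_ /(_ i)[_ ?]] := pyrP. Qed.

Lemma index_le_foot i z : z \in P i -> index z (P i) <= l i.
Proof.
rewrite index_foot -index_mem => lt_z.
by rewrite -ltnS (ltn_predK lt_z).
Qed.

Lemma index_gt0 i z : z \in P i -> (0 < index z (P i)) = (z != a).
Proof.
move=> zP; rewrite lt0n -(index_apex i); congr negb.
by apply/eqP/eqP=> [/(index_inj z zP (apex_in i))|->].
Qed.

Lemma index_lt_foot i z : z \in P i -> (index z (P i) < l i) = (z != b i).
Proof.
move=> zP; rewrite ltn_neqAle index_le_foot // andbT; congr negb.
by apply/eqP/eqP=> [/(index_inj z zP (foot_in i))|->].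
Qed.

Lemma pyr_adj i u v : u \in P i -> v \in P i ->
  e u v = (index v (P i) == (index u (P i)).+1)
       || (index u (P i) == (index v (P i)).+1).
Proof. by have [_ _] := pyr_path i; apply. Qed.

Lemma pyr_meet i j z : i != j -> z \in P i -> z \in P j -> z = a.
Proof. by have [_ _ + _ _] := pyrP; apply. Qed.

Lemma pyr_cross i j u v : i != j -> u \in P i -> v \in P j ->
  0 < index u (P i) -> 0 < index v (P j) -> e u v -> u = b i /\ v = b j.
Proof.
move=> ij ui vj u_gt0 v_gt0; have [_ _ _ + _] := pyrP; apply=> //.
  by rewrite -(index_gt0 ui).
by rewrite -(index_gt0 vj).
Qed.

Lemma base_adj i j : i != j -> e (b i) (b j).
Proof. by have [+ _ _ _ _] := pyrP; apply. Qed.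

Lemma foot_neq_apex i : b i != a.
Proof. by rewrite -(index_gt0 (foot_in i)) index_foot_gt0. Qed.

Lemma foot_notin i j : i != j -> b i \notin P j.
Proof.
move=> ij; apply: contra (foot_neq_apex i) => bij.
by apply/eqP; apply: (pyr_meet ij) => //; apply: foot_in.
Qed.

Lemma off_pyr u i : u \notin H -> u \notin P i.
Proof.
apply: contra => ui; apply: (subsetP PH).
by rewrite inE; apply/existsP; exists i.
Qed.

(** Bounds are inclusive: [seg i 1 (l i).-1] is the interior of leg [i], and [seg i 1 (l i)] is the
    leg without the apex. *)
Definition seg i m n := [set z | (z \in P i) && (m <= index z (P i) <= n)].

Lemma in_seg i m n z :
  (z \in seg i m n) = (z \in P i) && (m <= index z (P i) <= n).
Proof. by rewrite inE. Qed.

Lemma mem_seg i m n z : z \in P i ->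
  m <= index z (P i) -> index z (P i) <= n -> z \in seg i m n.
Proof. by move=> zi mz zn; rewrite in_seg zi mz. Qed.

Lemma seg_conn i S x y : x \in P i -> y \in P i ->
  (forall z, z \in P i ->
     (index x (P i) <= index z (P i) <= index y (P i)) ||
     (index y (P i) <= index z (P i) <= index x (P i)) -> z \in S) ->
  conn e S x y.
Proof.
move=> xP yP sub; have [le_xy|lt_yx] := leqP (index x (P i)) (index y (P i)).
  apply: (path_seg_conn (pyr_path i)) => // z zP iz.
  by rewrite sub // iz.
rewrite conn_sym //; apply: (path_seg_conn (pyr_path i)) => // [|z zP iz].
  exact: ltnW.
by rewrite sub // iz orbT.
Qed.

Lemma seg_sep i m n m' n' : n.+1 < m' -> sep e (seg i m n) (seg i m' n').
Proof.
move=> gap u v; rewrite !in_seg => /and3P[ui _ un] /and3P[vi mv _].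
by rewrite (pyr_adj ui vi); split; [apply/eqP=> uv; move: mv; rewrite -uv|]; nat_lia.
Qed.

(** Away from the apex the only edge between two legs joins their feet, so it is enough that one
    segment stops short of its foot. *)
Lemma seg_cross i j m n m' n' : i != j -> 0 < m -> 0 < m' ->
  (n < l i) || (n' < l j) -> sep e (seg i m n) (seg j m' n').
Proof.
move=> ij m0 m'0 lt_n u v; rewrite !in_seg => /and3P[ui mu un] /and3P[vj mv vn].
have u_gt0 : 0 < index u (P i) by nat_lia.
have v_gt0 : 0 < index v (P j) by nat_lia.
split.
  apply/eqP=> uv; move: u_gt0; rewrite index_gt0 //; case/negP; apply/eqP.
  by apply: (pyr_meet ij) => //; rewrite uv.
apply/negP=> /(pyr_cross ij ui vj u_gt0 v_gt0)[ub vb].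
by move: un vn lt_n; rewrite ub vb -/(l i) -/(l j); nat_lia.
Qed.

Lemma off_sep Q i m n : (forall u, u \in Q -> u \notin H) ->
  (forall u z, u \in Q -> z \in P i -> m <= index z (P i) <= n -> ~~ e u z) ->
  sep e Q (seg i m n).
Proof.
move=> offQ nQ u v uQ; rewrite in_seg => /andP[vi iv]; split; last exact: nQ.
by apply: contraNneq (off_pyr i (offQ u uQ)) => ->.
Qed.

(** * Thetas with the apex as an end *)

Lemma apex_foot_nonadj u i : u \notin H -> e u (b i) -> ~~ e a (b i).
Proof.
move=> uH /(far_apex uH (foot_in i)); rewrite (pyr_adj (apex_in i) (foot_in i)).
by rewrite index_apex; case: (index _ _) => [|[]].
Qed.

(* Ends [a] and [b j]: through [P i] and [Q], along [P j], and along [P k]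
   followed by the edge [b k]-[b j]. *)
Lemma theta_apex_foot i j k Q q1 q2 x :
  i != j -> i != k -> j != k ->
  (forall u, u \in Q -> u \notin H) ->
  conn e Q q1 q2 -> q1 \in Q -> q2 \in Q ->
  x \in P i -> x != b i -> e q1 x -> e q2 (b j) ->
  (forall u z, u \in Q -> z \in P j -> e u z -> z = b j) ->
  (forall u z, u \in Q -> z \in P k -> ~~ e u z) -> False.
Proof.
move=> ij ik jk offQ cQ q1Q q2Q xi xNb q1x q2b Qj Qk.
have x_far := far_apex (offQ _ q1Q) xi q1x.
have x_lt : index x (P i) < l i by rewrite index_lt_foot.
apply: (@theta_of_sets _ e e_sym e_irr a (b j) (Q :|: seg i 1 (l i).-1)
  (seg j 1 (l j).-1) (seg k 1 (l k)) no_theta).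
- by rewrite eq_sym foot_neq_apex.
- exact: apex_foot_nonadj (offQ _ q2Q) q2b.
- apply: (@conn_trans _ _ _ _ x).
    apply: (seg_conn (apex_in i)) => // z zi; rewrite index_apex => iz.
    have [->|za] := eqVneq z a; first by rewrite !inE eqxx.
    rewrite -(index_gt0 zi) in za.
    by rewrite 2!in_setU1 in_setU mem_seg ?orbT //; nat_lia.
  apply: (@conn_trans _ _ _ _ q1).
    apply: conn_edge; last by rewrite e_sym.
      by rewrite 2!in_setU1 in_setU mem_seg ?orbT //; nat_lia.
    by rewrite !inE q1Q !orbT.
  apply: (@conn_trans _ _ _ _ q2).
    apply: conn_sub cQ; apply/subsetP=> u uQ.
    by rewrite !inE uQ !orbT.
  by apply: conn_edge; rewrite // !inE ?q2Q ?eqxx !orbT.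
- apply: (seg_conn (apex_in j) (foot_in j)) => z zj _.
  have [->|za] := eqVneq z a; first by rewrite !inE eqxx.
  have [->|zb] := eqVneq z (b j); first by rewrite !inE eqxx orbT.
  rewrite -(index_gt0 zj) in za; rewrite -(index_lt_foot zj) in zb.
  by rewrite 2!in_setU1 mem_seg ?orbT //; nat_lia.
- apply: (@conn_trans _ _ _ _ (b k)).
    apply: (seg_conn (apex_in k) (foot_in k)) => z zk _.
    have [->|za] := eqVneq z a; first by rewrite !inE eqxx.
    rewrite -(index_gt0 zk) in za; have ? := index_le_foot zk.
    by rewrite 2!in_setU1 mem_seg ?orbT //; nat_lia.
  apply: conn_edge; last by rewrite base_adj // eq_sym.
    by rewrite !inE foot_in /= index_foot_gt0 leqnn !orbT.
  by rewrite !inE eqxx orbT.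
- apply: sepUl; last by apply: seg_cross => //; nat_lia.
  apply: off_sep => // u z uQ zj iz; apply/negP=> /(Qj u z uQ zj) zb.
  by move: iz; rewrite zb -/(l j); have := index_foot_gt0 j; nat_lia.
- apply: sepUl; last by apply: seg_cross => //; have := index_foot_gt0 i; nat_lia.
  by apply: off_sep => // u z uQ zk _; apply: Qk.
- by apply: seg_cross => //; have := index_foot_gt0 j; nat_lia.
Qed.

Lemma leg_conn i n p x : x \in P i -> 0 < index x (P i) <= n -> e p x ->
  conn e (p |: (a |: seg i 1 n)) p a.
Proof.
move=> xi /andP[x_gt0 x_le] px; apply: (@conn_trans _ _ _ _ x).
  apply: conn_edge; rewrite // ?setU11 //.
  by rewrite 2!in_setU1 mem_seg ?orbT.
apply: (seg_conn xi (apex_in i)) => z zi; rewrite index_apex => iz.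
have [->|za] := eqVneq z a; first by rewrite !inE eqxx orbT.
rewrite -(index_gt0 zi) in za.
by rewrite 2!in_setU1 mem_seg ?orbT //; nat_lia.
Qed.

Lemma off_apex_nonadj p i : p \notin H -> ~~ e p a.
Proof.
by move=> pH; apply/negP=> /(far_apex pH (apex_in i)); rewrite index_apex.
Qed.

(** The theta has ends [p] and [a], with one path down each leg from a neighbor of [p]. The third
    segment may contain its foot because the other two stop before theirs. *)
Lemma theta_apex_vertex i j k p x y z :
  i != j -> i != k -> j != k -> p \notin H ->
  x \in P i -> x != b i -> e p x -> y \in P j -> y != b j -> e p y ->
  z \in P k -> e p z -> False.
Proof.
move=> ij ik jk pH xi xb px yj yb py zk pz.
have x_far := far_apex pH xi px; have y_far := far_apex pH yj py.
have z_far := far_apex pH zk pz; have z_le := index_le_foot zk.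
have x_lt := xb; rewrite -(index_lt_foot xi) in x_lt.
have y_lt := yb; rewrite -(index_lt_foot yj) in y_lt.
apply: (@theta_of_sets _ e e_sym e_irr p a (seg i 1 (l i).-1)
  (seg j 1 (l j).-1) (seg k 1 (l k)) no_theta).
- by apply: contraNneq (off_pyr i pH) => ->; apply: apex_in.
- exact: off_apex_nonadj.
- by apply: (leg_conn xi) => //; nat_lia.
- by apply: (leg_conn yj) => //; nat_lia.
- by apply: (leg_conn zk) => //; nat_lia.
- by apply: seg_cross => //; nat_lia.
- by apply: seg_cross => //; nat_lia.
- by apply: seg_cross => //; nat_lia.
Qed.

(** * A connected set attaching to two legs away from their feet *)

Section TwoLegs.

Variables (i j k : 'I_3) (Q : {set T}) (q1 q2 : T).
Hypotheses (ij : i != j) (ik : i != k) (jk : j != k).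
Hypothesis offQ : forall u, u \in Q -> u \notin H.
Hypotheses (q1Q : q1 \in Q) (q2Q : q2 \in Q) (cQ : conn e Q q1 q2).
Hypothesis Qi : forall u z, u \in Q -> z \in P i -> e u z -> u = q1.
Hypothesis Qk : forall u z, u \in Q -> z \in P k -> ~~ e u z.
Variables (x0 y0 : T).
Hypotheses (x0i : x0 \in P i) (x0b : x0 != b i) (q1x0 : e q1 x0).
Hypotheses (y0j : y0 \in P j) (y0b : y0 != b j) (q2y0 : e q2 y0).

Let y0_far : 1 < index y0 (P j).
Proof. exact: far_apex (offQ q2Q) y0j q2y0. Qed.

Let y0_lt : index y0 (P j) < l j.
Proof. by rewrite index_lt_foot. Qed.

Let q1_far z : z \in P i -> e q1 z -> 1 < index z (P i).
Proof. by move=> zi; apply: far_apex (offQ q1Q) zi. Qed.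

(* Otherwise [x] and [a] are the ends of a theta: down [P i], through [Q] and
   [P j], and up [P i] followed by [P k]. *)
Lemma two_nbrs x : x \in P i -> x != b i -> e q1 x ->
  exists y, [/\ y \in P i, y != x & e q1 y].
Proof.
move=> xi xb q1x; have x_far := q1_far xi q1x.
case: (boolP [exists y, [&& y \in P i, y != x & e q1 y]]) => [/existsP[y]|].
  by move=> /and3P[]; exists y.
move=> /existsPn uniq_x; exfalso.
have x_lt := xb; rewrite -(index_lt_foot xi) in x_lt.
have Q_x u z : u \in Q -> z \in P i -> e u z -> z = x.
  move=> uQ zi uz; have uq := Qi uQ zi uz; apply/eqP/negPn/negP=> zx.
  by have := uniq_x z; rewrite zi zx -uq uz.
have j0 := index_foot_gt0 j; have k0 := index_foot_gt0 k.
(* [Q] and the interior of [P j] share one set, so edges between them do no harm. *)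
apply: (@theta_of_sets _ e e_sym e_irr x a (seg i 1 (index x (P i)).-1)
  (Q :|: seg j 1 (l j).-1)
  (seg i (index x (P i)).+1 (l i) :|: seg k 1 (l k)) no_theta).
- by rewrite -(index_gt0 xi); nat_lia.
- rewrite (pyr_adj xi (apex_in i)) index_apex; nat_lia.
- apply: (seg_conn xi (apex_in i)) => z zi; rewrite index_apex => iz.
  have [->|za] := eqVneq z a; first by rewrite !inE eqxx orbT.
  have [->|zx] := eqVneq z x; first by rewrite !inE eqxx.
  rewrite -(index_gt0 zi) in za.
  have zNx : index z (P i) <> index x (P i).
    by move=> /(index_inj x zi xi) /eqP; apply/negP.
  by rewrite 2!in_setU1 mem_seg ?orbT //; nat_lia.
- apply: (@conn_trans _ _ _ _ q1).
    apply: conn_edge; rewrite ?setU11 //; last by rewrite e_sym.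
    by rewrite !inE q1Q !orbT.
  apply: (@conn_trans _ _ _ _ q2).
    by apply: conn_sub cQ; apply/subsetP=> u uQ; rewrite !inE uQ !orbT.
  apply: (@conn_sub _ _ (q2 |: (a |: seg j 1 (l j).-1))).
    apply/subsetP=> u; rewrite 2!in_setU1 => /or3P[/eqP->|/eqP->|uj].
    + by rewrite !inE q2Q !orbT.
    + by rewrite !inE eqxx orbT.
    + by rewrite 2!in_setU1 in_setU uj !orbT.
  by apply: (leg_conn y0j) => //; nat_lia.
- apply: (@conn_trans _ _ _ _ (b i)).
    apply: (seg_conn xi (foot_in i)) => z zi iz.
    have [->|zx] := eqVneq z x; first by rewrite !inE eqxx.
    have zNx : index z (P i) <> index x (P i).
      by move=> /(index_inj x zi xi) /eqP; apply/negP.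
    have ? := index_le_foot zi.
    rewrite 2!in_setU1 in_setU mem_seg ?orbT //.
    by move: iz; rewrite -/(l i); nat_lia.
  apply: (@conn_sub _ _ (b i |: (a |: seg k 1 (l k)))).
    apply/subsetP=> u; rewrite 2!in_setU1 => /or3P[/eqP->|/eqP->|uk].
    + by rewrite 2!in_setU1 in_setU mem_seg ?foot_in ?orbT.
    + by rewrite !inE eqxx orbT.
    + by rewrite 2!in_setU1 in_setU uk !orbT.
  (* The base edge makes [b k] a neighbor of [b i] on leg [k], and that leg leads on to the apex. *)
  apply: (leg_conn (foot_in k)); rewrite ?base_adj // -/(l k); nat_lia.
- apply: (sepUr e_sym); last by apply: seg_cross => //; nat_lia.
  apply: (sep_sym e_sym); apply: off_sep => // u z uQ zi iz.
  by apply/negP=> /(Q_x _ _ uQ zi) zx; move: iz; rewrite zx; nat_lia.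
- by apply: (sepUr e_sym); [apply: seg_sep|apply: seg_cross => //]; nat_lia.
- apply: sepUl; apply: (sepUr e_sym).
  + apply: off_sep => // u z uQ zi iz.
    by apply/negP=> /(Q_x _ _ uQ zi) zx; move: iz; rewrite zx; nat_lia.
  + by apply: off_sep => // u z uQ zk _; apply: Qk.
  + by apply: seg_cross; rewrite // 1?eq_sym //; nat_lia.
  + by apply: seg_cross => //; nat_lia.
Qed.

(* Otherwise [q1] and [a] are the ends of a theta: down [P i] from [y], through
   [Q] and [P j], and up [P i] from [z] followed by [P k]. *)
Lemma nbrs_close y z : y \in P i -> z \in P i -> e q1 y -> e q1 z ->
  index z (P i) <= (index y (P i)).+1.
Proof.
move=> yi zi q1y q1z; rewrite leqNgt; apply/negP=> gap.
have y_far := q1_far yi q1y; have z_le := index_le_foot zi.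
have j0 := index_foot_gt0 j; have k0 := index_foot_gt0 k.
have q1H := offQ q1Q.
(* Only [q1] has neighbors on [P i], so the rest of [Q] is separated from the whole leg beyond the
   apex. *)
have Qi' : sep e (Q :\ q1) (seg i 1 (l i)).
  apply: off_sep => [u|u v]; rewrite in_setD1 => /andP[uq uQ]; first exact: offQ.
  by move=> vi _; apply: contra uq => /(Qi uQ vi)->.
have seg_sub m n : 0 < m -> n <= l i -> {subset seg i m n <= seg i 1 (l i)}.
  move=> m0 n_le u; rewrite in_seg => /and3P[ui mu un].
  by apply: mem_seg => //; nat_lia.
apply: (@theta_of_sets _ e e_sym e_irr q1 a (seg i 1 (index y (P i)))
  (Q :\ q1 :|: seg j 1 (l j).-1)
  (seg i (index z (P i)) (l i) :|: seg k 1 (l k)) no_theta).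
- by apply: contraNneq (off_pyr i q1H) => ->; apply: apex_in.
- exact: off_apex_nonadj.
- by apply: (leg_conn yi) => //; nat_lia.
- apply: (@conn_trans _ _ _ _ q2).
    (* [q1] is removed from the set but is an end of the theta, so all of [Q] remains available. *)
    apply: conn_sub cQ; apply/subsetP=> u uQ.
    by rewrite !inE uQ andbT; case: (u == q1); rewrite ?orbT.
  apply: (@conn_sub _ _ (q2 |: (a |: seg j 1 (l j).-1))).
    apply/subsetP=> u; rewrite 2!in_setU1 => /or3P[/eqP->|/eqP->|uj].
    + by rewrite !inE q2Q andbT; case: (q2 == q1); rewrite ?orbT.
    + by rewrite !inE eqxx orbT.
    + by rewrite 2!in_setU1 in_setU uj !orbT.
  by apply: (leg_conn y0j) => //; nat_lia.
- apply: (@conn_trans _ _ _ _ z).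
    apply: conn_edge => //; first by rewrite setU11.
    by rewrite 2!in_setU1 in_setU mem_seg ?orbT.
  apply: (@conn_trans _ _ _ _ (b i)).
    apply: (seg_conn zi (foot_in i)) => v vi iv.
    have ? := index_le_foot vi.
    rewrite 2!in_setU1 in_setU mem_seg ?orbT //.
    by move: iv; rewrite -/(l i); nat_lia.
  apply: (@conn_sub _ _ (b i |: (a |: seg k 1 (l k)))).
    apply/subsetP=> u; rewrite 2!in_setU1 => /or3P[/eqP->|/eqP->|uk].
    + by rewrite 2!in_setU1 in_setU mem_seg ?foot_in ?orbT.
    + by rewrite !inE eqxx orbT.
    + by rewrite 2!in_setU1 in_setU uk !orbT.
  apply: (leg_conn (foot_in k)); rewrite ?base_adj // -/(l k); nat_lia.
- apply: (sepUr e_sym); last by apply: seg_cross => //; nat_lia.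
  apply: (sep_sym e_sym) => u v uQ vi; apply: Qi' => //.
  by apply: seg_sub vi => //; nat_lia.
- by apply: (sepUr e_sym); [apply: seg_sep|apply: seg_cross => //]; nat_lia.
- apply: sepUl; apply: (sepUr e_sym).
  + by move=> u v uQ vi; apply: Qi' => //; apply: seg_sub vi => //; nat_lia.
  + apply: off_sep => [u|u v]; rewrite in_setD1 => /andP[_ uQ]; first exact: offQ.
    by move=> vk _; apply: Qk.
  + by apply: seg_cross; rewrite // 1?eq_sym //; nat_lia.
  + by apply: seg_cross => //; nat_lia.
Qed.

(* Otherwise the triangles [q1 y z] and [b j, b k, b i] span a prism. *)
Lemma consecutive_nbrs_foot y z : y \in P i -> z \in P i -> e q1 y -> e q1 z ->
  index z (P i) = (index y (P i)).+1 ->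
  (forall v, v \in P i -> e q1 v -> v = y \/ v = z) -> z = b i.
Proof.
move=> yi zi q1y q1z yz nq1; apply/eqP/negPn/negP=> zb.
have y_far := q1_far yi q1y; have z_le := index_le_foot zi.
have j0 := index_foot_gt0 j; have k0 := index_foot_gt0 k.
have q1H := offQ q1Q.
have yNz : y != z by apply/eqP=> E; move: yz; rewrite E; nat_lia.
have ya : y != a by rewrite -(index_gt0 yi); nat_lia.
have l_k u : u \in P k -> u != a -> u \in seg k 1 (l k).
  move=> uk; rewrite -(index_gt0 uk) => u0.
  by rewrite mem_seg // index_le_foot.
have far_j : 1 < l j by nat_lia.
have Qi2 u v : u \in Q -> v \in P i -> e u v -> u = q1 /\ (v = y \/ v = z).
  move=> uQ vi uv; have uq := Qi uQ vi uv; split=> //.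
  by apply: nq1 => //; rewrite -uq.
(* The paths run from [q1] through [Q] and leg [j] to [b j], from [y] through the apex to [b k], and
   from [z] up to [b i]. Leg [j] is entered only from position 2 on, because its vertex at position
   1 sees the apex, which lies in the second set; [y0] is far enough out for this. *)
apply: (@prism_of_sets _ e e_sym e_irr q1 y z (b j) (b k) (b i)
  (Q :|: seg j 2 (l j))
  (seg i 0 (index y (P i)) :|: seg k 1 (l k))
  (seg i (index z (P i)) (l i)) no_prism) => //.
- by rewrite (pyr_adj yi zi) yz eqxx.
- exact: base_adj.
- by rewrite base_adj // eq_sym.
- by rewrite base_adj // eq_sym.
- by apply: contraNneq (off_pyr j q1H) => ->; apply: foot_in.
- by apply: contraNneq (foot_notin (i := k) (j := i) _) => [<-//|]; rewrite eq_sym.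
- by rewrite in_setU q1Q.
- by rewrite in_setU mem_seg.
- by rewrite mem_seg.
- by rewrite in_setU mem_seg ?foot_in ?orbT.
- by rewrite in_setU orbC l_k ?foot_in ?foot_neq_apex.
- by rewrite mem_seg ?foot_in.
- apply: (@conn_trans _ _ _ _ q2).
    by apply: conn_sub cQ; apply: subsetUl.
  apply: (@conn_trans _ _ _ _ y0).
    apply: conn_edge; rewrite // in_setU ?q2Q //.
    by rewrite mem_seg ?orbT //; nat_lia.
  apply: (seg_conn y0j (foot_in j)) => v vj iv; have ? := index_le_foot vj.
  rewrite in_setU mem_seg ?orbT //.
  by move: iv; rewrite -/(l j); nat_lia.
- apply: (@conn_trans _ _ _ _ a).
    apply: (seg_conn yi (apex_in i)) => v vi; rewrite index_apex => iv.
    by rewrite in_setU mem_seg //; nat_lia.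
  apply: (seg_conn (apex_in k) (foot_in k)) => v vk _.
  have [->|va] := eqVneq v a; last by rewrite in_setU orbC l_k.
  by rewrite in_setU mem_seg ?apex_in ?index_apex.
- apply: (seg_conn zi (foot_in i)) => v vi iv; have ? := index_le_foot vi.
  by rewrite mem_seg //; move: iv; rewrite -/(l i); nat_lia.
- move=> u v; rewrite !in_setU !in_seg => uA vB.
  have uNv : u != v.
    apply/eqP=> E; subst v; case/orP: uA => [uQ|/and3P[uj u2 _]].
      have uH := offQ uQ.
      by case/orP: vB => /andP[+ _]; rewrite (negbTE (off_pyr _ uH)).
    have : u == a.
      case/orP: vB => /andP[uP _]; apply/eqP.
        by apply: (pyr_meet ij).
      by apply: (pyr_meet jk).
    by rewrite -[_ == _]negbK -(index_gt0 uj); nat_lia.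
  split=> // uv; case/orP: uA => [uQ|/and3P[uj u2 _]].
    case/orP: vB => [/and3P[vi _ viy]|/andP[vk _]].
      have [-> [->|vz]] := Qi2 u v uQ vi uv; first by left.
      by move: viy; rewrite vz; nat_lia.
    by have /negP := Qk uQ vk.
  right; have [va|va] := eqVneq v a.
    have : e u a by rewrite -va.
    rewrite (pyr_adj uj (apex_in j)) index_apex; nat_lia.
  case/orP: vB => [/and3P[vi _ viy]|/and3P[vk v1 _]].
    rewrite -(index_gt0 vi) in va.
    have ji : j != i by rewrite eq_sym.
    have u0 : 0 < index u (P j) by nat_lia.
    have [_ vb] := pyr_cross ji uj vi u0 va uv.
    by move: viy; rewrite vb -/(l i); nat_lia.
  by apply: (pyr_cross jk uj vk) => //; nat_lia.
- move=> u v; rewrite !in_setU !in_seg => uA /and3P[vi iv _].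
  have v0 : 0 < index v (P i) by nat_lia.
  have va : v != a by rewrite -(index_gt0 vi).
  case/orP: uA => [uQ|/and3P[uj u2 _]].
    split.
      by apply: contraNneq (off_pyr i (offQ uQ)) => ->.
    move=> /(Qi2 _ _ uQ vi)[-> [vy|->]]; last by left.
    by move: iv; rewrite vy; nat_lia.
  have ji : j != i by rewrite eq_sym.
  split.
    by apply: contraNneq va => uv; rewrite -(pyr_meet ij vi) // -uv.
  by move=> uv; right; apply: (pyr_cross ji) => //; nat_lia.
- move=> u v; rewrite !in_setU !in_seg => uA /and3P[vi iv _].
  have v0 : 0 < index v (P i) by nat_lia.
  have va : v != a by rewrite -(index_gt0 vi).
  case/orP: uA => [/and3P[ui _ iu]|/and3P[uk u1 _]].
    split; first by apply/eqP=> uv; move: iv; rewrite -uv; nat_lia.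
    rewrite (pyr_adj ui vi) => uv; left; split.
      by apply: (index_inj a ui yi); nat_lia.
    by apply: (index_inj a vi zi); nat_lia.
  have ki : k != i by rewrite eq_sym.
  split.
    by apply: contraNneq va => uv; rewrite -(pyr_meet ik vi) // -uv.
  by move=> uv; right; apply: (pyr_cross ki) => //; nat_lia.
Qed.

(** Let [y] be the neighbor of [q1] on leg [i] nearest the apex. There is a second neighbor, and
    every other neighbor sits at the position right after [y]; so there are exactly two, they are
    consecutive, and the later one is the foot. *)
Lemma nbrs_are_foot_edge : exists y,
  [/\ y \in P i, (index y (P i)).+1 = l i &
      forall z, z \in P i -> e q1 z = (z == y) || (z == b i)].
Proof.
have x0P : (x0 \in P i) && e q1 x0 by rewrite x0i.
pose y := [arg min_(v < x0 | (v \in P i) && e q1 v) index v (P i)].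
have [/andP[yi q1y] y_min] : ((y \in P i) && e q1 y) /\
    forall v, (v \in P i) && e q1 v -> index y (P i) <= index v (P i).
  by rewrite /y; case: arg_minnP.
(* [y] comes no later than [x0], which lies before the foot. *)
have yb : y != b i.
  rewrite -(index_lt_foot yi); apply: leq_ltn_trans (y_min x0 x0P) _.
  by rewrite index_lt_foot.
have [z [zi zy q1z]] := two_nbrs yi yb q1y.
have iNy v : v \in P i -> v != y -> e q1 v ->
    index v (P i) = (index y (P i)).+1.
  move=> vi vy q1v.
  have le1 := y_min v; rewrite vi q1v in le1; have {}le1 := le1 isT.
  have le2 := nbrs_close yi vi q1y q1v.
  have ne : index y (P i) <> index v (P i).
    by move=> /(index_inj v yi vi) E; rewrite E eqxx in vy.
  by nat_lia.
have nq1 v : v \in P i -> e q1 v -> v = y \/ v = z.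
  move=> vi q1v; have [->|vy] := eqVneq v y; first by left.
  by right; apply: (index_inj v vi zi); rewrite (iNy v) // (iNy z).
have zb := consecutive_nbrs_foot yi zi q1y q1z (iNy z zi zy q1z) nq1.
exists y; split=> // [|v vi]; first by rewrite -(iNy z) // zb.
apply/idP/orP=> [/(nq1 v vi)[->|->]|[/eqP->|/eqP->]] //.
- by left.
- by right; rewrite zb.
- by rewrite -zb.
Qed.

End TwoLegs.

(** * From attachments to jewels and corner paths *)

Lemma foot_nbr i u y : u \in P i -> y \in P i -> (index y (P i)).+1 = l i ->
  e u (b i) = (u == y).
Proof.
move=> ui yi yl; rewrite (pyr_adj ui (foot_in i)) -/(l i) -yl.
have u_le := index_le_foot ui.
apply/orP/eqP=> [[/eqP[E]|/eqP E]|->]; last by left.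
- exact: (index_inj a ui yi).
- by exfalso; nat_lia.
Qed.

(** Away from the apex, [b i] is the only vertex of leg [i] that can see [b j]; the apex itself is
    covered by the last hypothesis. *)
Lemma other_foot_nonadj i j u : i != j -> u \in P i -> u != b i ->
  ~~ e a (b j) -> ~~ e u (b j).
Proof.
move=> ij ui ub ab; have [->//|ua] := eqVneq u a.
rewrite -(index_gt0 ui) in ua; apply/negP=> uv.
have [E _] := pyr_cross ij ui (foot_in j) ua (index_foot_gt0 j) uv.
by rewrite E eqxx in ub.
Qed.

(** The two-leg analysis applies from both ends of [Q]: [q1] sees on leg [i] exactly the foot and
    its predecessor, and [q2] does the same on leg [j]. Once [q1 = q2], this is a jewel at the foot
    of the missed leg. *)
Lemma two_legs_jewel i j k Q q1 q2 x y :
  i != j -> i != k -> j != k ->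
  (forall u, u \in Q -> u \notin H) ->
  q1 \in Q -> q2 \in Q -> conn e Q q1 q2 ->
  (forall u z, u \in Q -> z \in P i -> e u z -> u = q1) ->
  (forall u z, u \in Q -> z \in P j -> e u z -> u = q2) ->
  (forall u z, u \in Q -> z \in P k -> ~~ e u z) ->
  x \in P i -> x != b i -> e q1 x -> y \in P j -> y != b j -> e q2 y ->
  q1 = q2 /\ jewel_at e b P k q1.
Proof.
move=> ij ik jk offQ q1Q q2Q cQ Qi Qj Qk xi xb q1x yj yb q2y.
have ji : j != i by rewrite eq_sym.
have [x1 [x1i x1l q1E]] := nbrs_are_foot_edge ij ik jk offQ q1Q q2Q cQ
  Qi Qk xi xb q1x yj yb q2y.
have cQ' : conn e Q q2 q1 by rewrite conn_sym.
have [y1 [y1j y1l q2E]] := nbrs_are_foot_edge ji jk ik offQ q2Q q1Q cQ'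
  Qj Qk yj yb q2y xi xb q1x.
have q1H := offQ q1 q1Q; have q2H := offQ q2 q2Q.
have q1b : e q1 (b i) by rewrite q1E ?foot_in ?eqxx ?orbT.
have q2b : e q2 (b j) by rewrite q2E ?foot_in ?eqxx ?orbT.
have abi := apex_foot_nonadj q1H q1b; have abj := apex_foot_nonadj q2H q2b.
have x1b : x1 != b i by rewrite -(index_lt_foot x1i) -x1l.
have y1b : y1 != b j by rewrite -(index_lt_foot y1j) -y1l.
have q1x1 : e q1 x1 by rewrite q1E ?eqxx.
have q2y1 : e q2 y1 by rewrite q2E ?eqxx.
have q12 : q1 = q2.
  (* Otherwise the triangles [q1 x1 (b i)] and [q2 y1 (b j)] span a prism. *)
  apply/eqP/negPn/negP => q12.
  have x1a : x1 != a.
    by rewrite -(index_gt0 x1i); have := far_apex q1H x1i q1x1; nat_lia.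
  have inB u : u \in [set z in P i | z != b i] :|: [set z in P j | z != b j] ->
      u \in P i /\ u != b i \/ u \in P j /\ u != b j.
    by rewrite !inE => /orP[]/andP[]; [left|right].
  (* The three paths run through [Q], through the apex from [x1] to [y1], and along the base edge
     from [b i] to [b j]. *)
  apply: (@prism_of_sets _ e e_sym e_irr q1 x1 (b i) q2 y1 (b j) Q
    ([set z in P i | z != b i] :|: [set z in P j | z != b j])
    [set b i; b j] no_prism) => //.
  - by rewrite (foot_nbr x1i x1i x1l).
  - by rewrite (foot_nbr y1j y1j y1l).
  - by apply: contraNneq x1a => E; rewrite (pyr_meet ij x1i) // E.
  - by apply: contraNneq (foot_notin ij) => ->; apply: foot_in.
  - by rewrite !inE x1i x1b.
  - by rewrite !inE eqxx.
  - by rewrite !inE y1j y1b orbT.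
  - by rewrite !inE eqxx orbT.
  - apply: (@conn_trans _ _ _ _ a).
      apply: (seg_conn x1i (apex_in i)) => v vi; rewrite index_apex => iv.
      rewrite !inE vi -(index_lt_foot vi) /=; apply/orP; left.
      by nat_lia.
    apply: (seg_conn (apex_in j) y1j) => v vj; rewrite index_apex => iv.
    rewrite !inE vj -(index_lt_foot vj) /=; apply/orP; right.
    by nat_lia.
  - by apply: conn_edge; rewrite ?base_adj // !inE eqxx ?orbT.
  - move=> u v uQ /inB[] [vP vb]; have uH := offQ u uQ; split;
      try by apply: contraNneq (off_pyr _ uH) => ->; exact: vP.
      move=> uv; have E := Qi u v uQ vP uv; rewrite E q1E // (negbTE vb) orbF in uv.
      by left; split; last exact/eqP.
    move=> uv; have E := Qj u v uQ vP uv; rewrite E q2E // (negbTE vb) orbF in uv.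
    by right; split; last exact/eqP.
  - move=> u v uQ; rewrite !inE => /orP[]/eqP->; have uH := offQ u uQ; split;
      try by apply: contraNneq (off_pyr _ uH) => ->; exact: foot_in.
      by move=> /(Qi u _ uQ (foot_in i)); left.
    by move=> /(Qj u _ uQ (foot_in j)); right.
  - move=> u v /inB[] [uP ub]; rewrite !inE => /orP[]/eqP->; split => //.
    + by rewrite (foot_nbr uP x1i x1l) => /eqP; left.
    + by apply: contraTneq uP => ->; apply: foot_notin.
    + by move/negP: (other_foot_nonadj ij uP ub abj).
    + by apply: contraTneq uP => ->; apply: foot_notin.
    + by move/negP: (other_foot_nonadj ji uP ub abi).
    + by rewrite (foot_nbr uP y1j y1l) => /eqP; right.
split=> //; rewrite -q12 in q2E.
(* The foot [b m] has [w] as its only neighbor on its leg, so its closed neighborhood there is the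
   pair seen by [q1]. *)
have legE m w : w \in P m -> (index w (P m)).+1 = l m ->
    (forall z, z \in P m -> e q1 z = (z == w) || (z == b m)) ->
    nbrs e [set z in P m] [set q1] = b m |: nbrs e [set z in P m] [set b m].
  move=> wm wl q1m; apply/setP=> z; rewrite !inE.
  have ex (c : T) : [exists y0 in [set c], e z y0] = e z c.
    apply/exists_inP/idP=> [[d]|zc]; first by rewrite inE => /eqP->.
    by exists c; rewrite // inE.
  rewrite !ex; have [->|zb] := eqVneq z (b m).
    rewrite foot_in andbT e_sym q1m ?foot_in // eqxx orbT andbT.
    by apply: contraNneq (off_pyr m q1H) => <-; apply: foot_in.
  have [zm|//] := boolP (z \in P m); last by rewrite !andbF.
  rewrite e_sym q1m // (negbTE zb) orbF (foot_nbr zm wm wl) !andbT.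
  have -> // : z != q1.
  by apply: contraNneq (off_pyr m q1H) => <-.
split=> [|z zk|m mk].
- rewrite inE; apply/existsP=> -[m]; exact/negP/off_pyr.
- exact: Qk.
have [->|mi] := eqVneq m i; first exact: legE x1i x1l q1E.
rewrite (ord3_third ij ik jk mi mk); exact: legE y1j y1l q2E.
Qed.

(** All that is missing from a corner path is that [q2] also sees the third foot [b k]. If it does
    not, [Q] misses leg [k] and meets leg [j] only in [b j], which gives a theta with ends [a] and
    [b j]. *)
Lemma corner_of_feet i j (Q : seq T) q1 q2 x :
  i != j -> path_between e q1 q2 Q -> (forall u, u \in Q -> u \notin H) ->
  (forall u z m, u \in Q -> z \in P m -> e u z -> z != b i ->
     (u = q1 /\ z \in P i) \/ (u = q2 /\ exists2 n, n != i & z = b n)) ->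
  x \in P i -> x != b i -> e q1 x -> e q2 (b j) -> corner_path_at e b P i Q.
Proof.
move=> ij Qp offQ QP xi xb q1x q2b; have [k [ik jk]] := ord3_other ij.
have [[Q0 uQ _] hQ lQ] := Qp.
have q1Q : q1 \in Q by rewrite -hQ; case: (Q) Q0 => //= *; rewrite inE eqxx.
have q2Q : q2 \in Q by rewrite -lQ; case: (Q) Q0 => //= *; apply: mem_last.
have ki : k != i by rewrite eq_sym.
have far_foot u z m : u \in Q -> m != i -> z \in P m -> e u z -> u = q2 /\ z = b m.
  move=> uQ' mi zm uz; have zb : z != b i.
    by apply: contraTneq zm => ->; apply: foot_notin; rewrite eq_sym.
  have [[_ zi]|[-> [n ni zn]]] := QP u z m uQ' zm uz zb.
    (* Legs [m] and [i] share only the apex, which no vertex off [H] sees. *)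
    have za := pyr_meet mi zm zi; move: uz; rewrite za => ua.
    by have := off_apex_nonadj i (offQ u uQ'); rewrite ua.
  have [<-//|nm] := eqVneq n m.
  by have := foot_notin nm; rewrite -zn zm.
have [q2bk|q2bk] := boolP (e q2 (b k)).
  exists q1, q2; split=> // [u uQ'|||u z uQ'].
  - by rewrite inE; apply/existsP=> -[m]; apply/negP/off_pyr/offQ.
  - by exists x.
  - move=> m mi; have [->//|mk] := eqVneq m k.
    by rewrite (ord3_third ij ik jk mi mk).
  - rewrite !inE => /andP[zb /existsP[m zm]] uz.
    by have := QP u z m uQ' zm uz zb.
exfalso.
apply: (@theta_apex_foot i j k [set u in Q] q1 q2 x) => //; rewrite ?inE //.
- by move=> u; rewrite inE => /offQ.
- apply: (@path_seg_conn _ _ Q) => //; first by case: Qp.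
    by rewrite -hQ; case: (Q) Q0 => //= *; rewrite eqxx.
  by move=> z zQ _; rewrite inE.
- move=> u z; rewrite inE => uQ' zj uz.
  by have [] := @far_foot u z j uQ' _ zj uz; rewrite 1?eq_sym.
- move=> u z; rewrite inE => uQ' zk; apply/negP=> uz.
  have [uq zb] := far_foot u z k uQ' ki zk uz.
  by rewrite -zb -uq uz in q2bk.
Qed.

(** * Attachments, locality, and the case of a single vertex *)

Definition attach (s : seq T) := nbrs e (pyr_set P) [set x in s].

Lemma attachP (s : seq T) z : (forall u, u \in s -> u \notin H) ->
  reflect ((exists i, z \in P i) /\ exists2 u, u \in s & e u z)
          (z \in attach s).
Proof.
move=> offs; rewrite !inE; apply: (iffP andP).
  move=> [/andP[_ /existsP zP] /exists_inP[u]]; rewrite inE => us zu.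
  by split=> //; exists u; rewrite // e_sym.
move=> [[i zi] [u us uz]]; split.
  apply/andP; split; last by apply/existsP; exists i.
  by apply/negP=> /offs; apply/negP; rewrite negbK (subsetP PH) // inE;
    apply/existsP; exists i.
by apply/exists_inP; exists u; rewrite ?inE // e_sym.
Qed.

Definition localb (X : {set T}) :=
  [exists i, X \subset P i] || (X \subset codom b).

Lemma localP X : reflect (local_in b P X) (localb X).
Proof.
apply: (iffP orP) => [[/existsP[i /subsetP XP]|/subsetP Xb]|[[i XP]|Xb]].
- by left; exists i.
- by right=> x /Xb /codomP.
- by left; apply/existsP; exists i; apply/subsetP.
- by right; apply/subsetP=> x /Xb[i ->]; apply: codom_f.
Qed.

Lemma nonlocalP X : ~~ localb X ->
  (exists2 z, z \in X & forall i, z != b i) /\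
  (forall i, exists2 z, z \in X & z \notin P i).
Proof.
rewrite negb_or => /andP[/existsPn XP /subsetPn[z zX zb]]; split.
  by exists z => // i; apply: contraNneq zb => ->; apply: codom_f.
by move=> i; apply/subsetPn; apply: XP.
Qed.

(** Take a neighbor [x] of [p] that is no foot, on leg [i], and a neighbor [z] off that leg, on leg
    [j]. If [p] has a neighbor before the foot on a second leg, it gives a theta when all three legs
    are met and a jewel at the foot of the missed leg otherwise. If not, [p] alone is a corner path
    at [b i]. *)
Lemma vertex_case p : p \notin H -> ~~ localb (attach [:: p]) ->
  corner_path e b P [:: p] \/ jewel e b P p.
Proof.
move=> pH; have offp u : u \in [:: p] -> u \notin H by rewrite inE => /eqP->.
move=> /nonlocalP[[x /attachP[] // [i xi] [u]]].
rewrite inE => /eqP-> {u} px xb /(_ i)[z /attachP[] // [j zj] [u]].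
rewrite inE => /eqP-> {u} pz zi.
have ij : i != j by apply: contraNneq zi => ->.
have [k [ik jk]] := ord3_other ij.
have kj : k != j by rewrite eq_sym.
have [/exists_inP[y yj /andP[yb py]]|noj] :=
    boolP [exists y in P j, (y != b j) && e p y].
  have [/exists_inP[w wk pw]|/exists_inPn nok] := boolP [exists w in P k, e p w].
    by have := theta_apex_vertex ij ik jk pH xi (xb i) px yj yb py wk pw.
  right; exists k.
  have [] := @two_legs_jewel i j k [set p] p p x y ij ik jk; rewrite ?inE //.
  - by move=> u; rewrite inE => /eqP->.
  - exact: connect0.
  - by move=> u v; rewrite inE => /eqP.
  - by move=> u v; rewrite inE => /eqP.
  - by move=> u v; rewrite inE => /eqP-> vk; apply: nok.
have nojP y : y \in P j -> e p y -> y = b j.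
  move=> yj py; apply/eqP/negPn/negP=> yb.
  by case/exists_inP: noj; exists y; rewrite // yb.
have [/exists_inP[y yk /andP[yb py]]|nok] :=
    boolP [exists y in P k, (y != b k) && e p y].
  by have := theta_apex_vertex ik ij kj pH xi (xb i) px yk yb py zj pz.
left; exists i; apply: (@corner_of_feet i j [:: p] p p x) => //.
- by split=> //; apply: is_path1.
- move=> u v m; rewrite inE => /eqP-> vm pv vb.
  have [mi|mi] := eqVneq m i; first by left; rewrite -mi.
  right; split=> //; exists m => //.
  have [mk|mk] := eqVneq m k.
    rewrite mk in vm *; apply/eqP/negPn/negP=> yb.
    by case/exists_inP: nok; exists v; rewrite // yb.
  have mj := ord3_third ij ik jk mi mk.
  by rewrite mj; apply: nojP; rewrite // -mj.
- by rewrite -(nojP z).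
Qed.

(** * Nonlocal paths with distinct ends and local proper subpaths *)

Section TwoEnds.

Variables (Q : seq T) (q1 q2 : T).
Hypotheses (Qp : path_between e q1 q2 Q) (q12 : q1 != q2).
Hypothesis offQ : forall u, u \in Q -> u \notin H.
Hypothesis nonlocQ : ~~ localb (attach Q).

(** By nonlocality some attachment is no foot, and only [q1] can provide it; some attachment is off
    leg [i], and only [q2] can provide it, necessarily at a foot [b j]. Inner vertices can see
    nothing but [b i]. *)
Lemma leg_base_corner i :
  (forall u z m, u \in Q -> u != q2 -> z \in P m -> e u z -> z \in P i) ->
  (forall u z m, u \in Q -> u != q1 -> z \in P m -> e u z ->
     exists n, z = b n) ->
  corner_path_at e b P i Q.
Proof.
move=> Qi Qb; have [[x /attachP[] // [m xm] [u uQ ux] xb] H2] := nonlocalP nonlocQ.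
have [z /attachP[] // [n zn] [v vQ vz] zi] := H2 i.
have uq : u = q1.
  apply/eqP/negPn/negP=> uq; have [n' xn] := Qb u x m uQ uq xm ux.
  by have := xb n'; rewrite xn eqxx.
have vq : v = q2.
  by apply/eqP/negPn/negP=> vq; rewrite (Qi v z n) in zi.
have [j zj] : exists j, z = b j by apply: (Qb v z n) => //; rewrite vq eq_sym.
have ij : i != j by apply: contraNneq zi => ->; rewrite zj foot_in.
apply: (@corner_of_feet i j Q q1 q2 x) => //.
- move=> w y l' wQ yl wy yb; have [wq|wq] := eqVneq w q1.
    by left; split=> //; apply: (Qi w y l') => //; rewrite wq.
  have [k yk] := Qb w y l' wQ wq yl wy.
  have ki : k != i by apply: contraNneq yb => <-; rewrite yk.
  right; split; last by exists k.
  apply/eqP/negPn/negP=> wq2.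
  by have := Qi w y l' wQ wq2 yl wy; rewrite yk (negbTE (foot_notin ki)).
- by apply: (Qi u x m) => //; rewrite uq.
- by rewrite -uq.
- by rewrite -zj -vq.
Qed.

End TwoEnds.

(** Nonlocality makes the legs distinct, so an inner vertex could attach only at the apex, hence
    attaches nowhere. If an end sees nothing but the foot of its leg, the leg-and-base case applies,
    after reversal when that end is [q1]. Otherwise the two-leg analysis forces [q1 = q2]. *)
Lemma leg_leg_corner i j (Q : seq T) q1 q2 :
  path_between e q1 q2 Q -> q1 != q2 -> (forall u, u \in Q -> u \notin H) ->
  ~~ localb (attach Q) ->
  (forall u z m, u \in Q -> u != q2 -> z \in P m -> e u z -> z \in P i) ->
  (forall u z m, u \in Q -> u != q1 -> z \in P m -> e u z -> z \in P j) ->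
  corner_path_at e b P i Q \/ corner_path_at e b P j (rev Q).
Proof.
move=> Qp q12 offQ nonlocQ Qi Qj.
have [[Q0 uQ _] hQ lQ] := Qp.
have q1Q : q1 \in Q by rewrite -hQ; case: (Q) Q0 => //= *; rewrite inE eqxx.
have q2Q : q2 \in Q by rewrite -lQ; case: (Q) Q0 => //= *; apply: mem_last.
have [_ H2] := nonlocalP nonlocQ.
have ij : i != j.
  apply/eqP=> E; have [z /attachP[] // [n zn] [v vQ vz]] := H2 i.
  case/negP; have [vq|vq] := eqVneq v q2; last exact: (Qi v z n).
  by rewrite E; apply: (Qj v z n) => //; rewrite vq eq_sym.
have [k [ik jk]] := ord3_other ij.
have apexF u z : u \in Q -> e u z -> z = a -> False.
  move=> uQ' uz za; rewrite za in uz.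
  by have := off_apex_nonadj i (offQ u uQ'); rewrite uz.
have hi u z : u \in Q -> z \in P i -> e u z -> u = q1.
  move=> uQ' zi uz; apply/eqP/negPn/negP=> uq.
  by apply: (apexF u z uQ' uz); apply: (pyr_meet ij) => //; apply: (Qj u z i).
have hj u z : u \in Q -> z \in P j -> e u z -> u = q2.
  move=> uQ' zj uz; apply/eqP/negPn/negP=> uq.
  by apply: (apexF u z uQ' uz); apply: (pyr_meet ij) => //; apply: (Qi u z j).
have hk u z : u \in Q -> z \in P k -> ~~ e u z.
  move=> uQ' zk; apply/negP=> uz; apply: (apexF u z uQ' uz).
  have [uq|uq] := eqVneq u q2; last first.
    by apply: (pyr_meet ik) => //; apply: (Qi u z k).
  apply: (pyr_meet jk) => //; apply: (Qj u z k) => //.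
  by rewrite uq eq_sym.
have [/exists_inP[x xi /andP[xb q1x]]|noi] :=
    boolP [exists x in P i, (x != b i) && e q1 x]; last first.
  right; have Qr u : (u \in rev Q) = (u \in Q) by rewrite mem_rev.
  apply: (@leg_base_corner (rev Q) q2 q1) => //.
  - exact: path_between_rev.
  - by rewrite eq_sym.
  - by move=> u; rewrite Qr; apply: offQ.
  - suff -> : attach (rev Q) = attach Q by [].
    by rewrite /attach; congr nbrs; apply/setP=> u; rewrite !inE Qr.
  - by move=> u z m; rewrite Qr; apply: Qj.
  - move=> u z m; rewrite Qr => uQ' uq zm uz; exists i.
    have zi := Qi u z m uQ' uq zm uz; have uq1 := hi u z uQ' zi uz.
    apply/eqP/negPn/negP=> zb; case/exists_inP: noi; exists z => //.
    by rewrite zb -uq1.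
have [/exists_inP[y yj /andP[yb q2y]]|noj] :=
    boolP [exists x in P j, (x != b j) && e q2 x]; last first.
  left; apply: (@leg_base_corner Q q1 q2) => // u z m uQ' uq zm uz; exists j.
  have zj := Qj u z m uQ' uq zm uz; have uq2 := hj u z uQ' zj uz.
  apply/eqP/negPn/negP=> zb; case/exists_inP: noj; exists z => //.
  by rewrite zb -uq2.
have [] := @two_legs_jewel i j k [set u in Q] q1 q2 x y ij ik jk; rewrite ?inE //.
- by move=> u; rewrite inE => /offQ.
- apply: (@path_seg_conn _ _ Q) => //; first by case: Qp.
    by rewrite -hQ; case: (Q) Q0 => //= *; rewrite eqxx.
  by move=> z zQ _; rewrite inE.
- by move=> u z; rewrite inE; apply: hi.
- by move=> u z; rewrite inE; apply: hj.
- by move=> u z; rewrite inE; apply: hk.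
by move=> E; rewrite E eqxx in q12.
Qed.

(** Induction on the length allows every shorter nonempty subpath to be taken local. For two or more
    vertices only the subpaths lacking one end matter, and each is local through a leg or through
    the base. *)
Lemma corner_or_jewel s :
  is_path e s -> (forall u, u \in s -> u \notin H) -> ~~ localb (attach s) ->
  (exists2 Q, subpath Q s & corner_path e b P Q) \/
  (exists2 x, x \in s & jewel e b P x).
Proof.
move: {2}(size s) (leqnn (size s)) => n; elim: n s => [|n IHn] s le_n.
  by case=> [+ _ _]; case: s le_n.
move=> s_path offs nonloc.
have lift r : infix r s -> 0 < size r < size s -> ~~ localb (attach r) ->
  (exists2 Q, subpath Q s & corner_path e b P Q) \/
  (exists2 x, x \in s & jewel e b P x).
  move=> rs /andP[r0 r_lt] nonr; have sub_rs := mem_infix rs.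
  have r_n : size r <= n by rewrite -ltnS; apply: leq_trans le_n.
  have r_path := is_path_infix rs r0 s_path.
  have offr u : u \in r -> u \notin H by move=> /sub_rs; apply: offs.
  have [[Q Qr Qc]|[x xr xj]] := IHn r r_n r_path offr nonr.
  - left; exists Q => //.
    by case/orP: Qr => Qr; apply/orP; [left|right]; apply: infix_trans rs.
  - by right; exists x => //; apply: sub_rs.
case: s => [|q1 rest] in le_n s_path offs nonloc lift *; first by case: s_path.
case: rest => [|w t] in le_n s_path offs nonloc lift *.
  have q1H : q1 \notin H by apply: offs; rewrite inE.
  have [Qc|pj] := vertex_case q1H nonloc.
    by left; exists [:: q1] => //; rewrite /subpath infix_refl.
  by right; exists q1; rewrite // inE.
set s := q1 :: w :: t in le_n s_path offs nonloc lift *.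
(* [front] drops the last vertex of [s], and [w :: t] drops the first. *)
pose q2 := last w t; pose front := q1 :: belast w t.
have sE : s = rcons front q2 by rewrite /s /front /q2 rcons_cons -lastI.
have [loc1|] := boolP (localb (attach (w :: t))); last first.
  apply: lift; rewrite ?leqnn //.
  by apply/infixP; exists [:: q1], [::]; rewrite cats0.
have [loc2|] := boolP (localb (attach front)); last first.
  apply: lift; last by rewrite /= size_belast ltnS leqnn.
  by apply/infixP; exists [::], [:: q2]; rewrite sE -cats1.
have [_ us _] := s_path.
have s_btw : path_between e q1 q2 s by [].
have q12 : q1 != q2.
  move: us; rewrite cons_uniq => /andP[+ _]; apply: contraNneq => ->.
  exact: mem_last.
have in_rest u : u \in s -> u != q1 -> u \in w :: t.
  by rewrite in_cons => /predU1P[->|//]; rewrite eqxx.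
have in_front u : u \in s -> u != q2 -> u \in front.
  by rewrite sE mem_rcons in_cons => /predU1P[->|//]; rewrite eqxx.
have offr u : u \in w :: t -> u \notin H.
  by move=> ut; apply: offs; rewrite in_cons ut orbT.
have offf u : u \in front -> u \notin H.
  by move=> ut; apply: offs; rewrite sE mem_rcons in_cons ut orbT.
have attr u z m : u \in s -> u != q1 -> z \in P m -> e u z -> z \in attach (w :: t).
  move=> us' uq zm uz; apply/attachP=> //; split; first by exists m.
  by exists u => //; apply: in_rest.
have attf u z m : u \in s -> u != q2 -> z \in P m -> e u z -> z \in attach front.
  move=> us' uq zm uz; apply/attachP=> //; split; first by exists m.
  by exists u => //; apply: in_front.
have sub_s : subpath s s by rewrite /subpath infix_refl.
have sub_rev : subpath (rev s) s by rewrite /subpath revK infix_refl orbT.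
left; case/localP: loc2 => [[i fi]|fb]; case/localP: loc1 => [[j rj]|rb].
- have [||c|c] := @leg_leg_corner i j s q1 q2 s_btw q12 offs nonloc.
  + by move=> u z m us' uq zm uz; apply: fi; apply: (attf u z m).
  + by move=> u z m us' uq zm uz; apply: rj; apply: (attr u z m).
  + by exists s => //; exists i.
  + by exists (rev s) => //; exists j.
- exists s => //; exists i; apply: (@leg_base_corner s q1 q2) => //.
  + by move=> u z m us' uq zm uz; apply: fi; apply: (attf u z m).
  + by move=> u z m us' uq zm uz; apply: rb; apply: (attr u z m).
- exists (rev s) => //; exists j; apply: (@leg_base_corner (rev s) q2 q1) => //.
  + exact: path_between_rev.
  + by rewrite eq_sym.
  + by move=> u; rewrite mem_rev; apply: offs.
  + suff -> : attach (rev s) = attach s by [].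
    by rewrite /attach; congr nbrs; apply/setP=> u; rewrite 2!in_set mem_rev.
  + by move=> u z m; rewrite mem_rev => us' uq zm uz; apply: rj; apply: (attr u z m).
  + by move=> u z m; rewrite mem_rev => us' uq zm uz; apply: fb; apply: (attf u z m).
(* As [q1 != q2], every vertex of [s] lies in [front] or in [w :: t]; with both attaching only to
   the base, [s] would be local. *)
- case/negP: nonloc; apply/localP; right=> z /attachP[] // [m zm] [u us' uz].
  have [uq|uq] := eqVneq u q1.
    by apply: fb; apply: (attf u z m) => //; rewrite uq.
  by apply: rb; apply: (attr u z m).
Qed.

End Pyramid.

(** * From trapping to the conclusion *)

Lemma trapped_far (T : finType) (e : rel T) (H : {set T}) a b P u z i :
  symmetric e -> trapped e H a -> is_pyramid e a b P ->
  u \notin H -> z \in P i -> e u z -> 1 < index z (P i).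
Proof.
move=> e_sym [near_in _] pyrP uH zi uz; rewrite ltnNge; apply/negP=> le1.
have ai := apex_in pyrP i; have a0 := index_apex pyrP i.
case/negP: uH; apply: near_in; rewrite e_sym in uz.
(* At position 0, [z] is the apex and [u] is its neighbor; at position 1, [u] is reached from the
   apex in two steps through [z]. *)
have [za|za] := eqVneq z a; first by exists [:: u]; rewrite /= -za uz.
have az : e a z.
  rewrite -(index_gt0 pyrP zi) in za.
  by rewrite (pyr_adj pyrP ai zi) a0; apply/orP; left; nat_lia.
by exists [:: z; u]; rewrite /= az uz.
Qed.

Theorem theorem3p2 (T : finType) (e : rel T)
    (e_sym : symmetric e) (e_irr : irreflexive e)
    (G_theta_free : theta_free e) (G_prism_free : prism_free e)
    (H : {set T}) (a : T) (aH : a \in H) (a_trapped : trapped e H a)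
    (b : 'I_3 -> T) (Pi : 'I_3 -> seq T)
    (Sigma_pyramid : is_pyramid e a b Pi) (Sigma_in_H : pyr_set Pi \subset H)
    (P : seq T) (P_path : is_path e P) (P_off_H : forall x, x \in P -> x \notin H) :
  [\/ local_in b Pi (nbrs e (pyr_set Pi) [set x in P]),
      exists2 Q, subpath Q P & corner_path e b Pi Q |
      exists2 x, x \in P & jewel e b Pi x].
Proof.
have far u z i := @trapped_far T e H a b Pi u z i e_sym a_trapped Sigma_pyramid.
have [/localP|nonloc] := boolP (localb b Pi (attach e Pi P)).
  by constructor 1.
have [] := corner_or_jewel e_sym e_irr G_theta_free G_prism_free
  Sigma_pyramid Sigma_in_H far P_path P_off_H nonloc.
- by constructor 2.
- by constructor 3.
Qed.
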